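(* There are infinitely many (pairwise non-isomorphic) finite Frobenius groups $G$ such that $\Gamma(G)=\Gamma(\mathrm{PGL}(2,49))$.
   Context: For a finite group $G$, $\pi(G)$ denotes the set of prime divisors of $|G|$. The prime graph $\Gamma(G)$ is the simple graph with vertex set $\pi(G)$ in which two distinct primes $p,q$ are adjacent if and only if $G$ contains an element of order $pq$. Equality $\Gamma(H)=\Gamma(G)$ means that the two graphs have the same vertex set (of primes) and the same edges. $\mathrm{PGL}(2,49)$ is the projective general linear group of dimension $2$ over the field with $49$ elements. *)

(* Defs.v *)
From mathcomp Require Import all_boot all_algebra all_fingroup all_solvable.

Set Implicit Arguments.
Unset Strict Implicit.
Unset Printing Implicit Defensive.

Local Open Scope group_scope.

(* The vertex set of the prime graph of G is \pi(G). *)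
Definition prime_graph_edge (gT : finGroupType) (G : {group gT}) : rel nat :=
  fun p q => [&& p \in \pi(G), q \in \pi(G), p != q
               & [exists x in G, #[x] == (p * q)%N]].

Definition eq_prime_graph (gT rT : finGroupType)
    (G : {group gT}) (H : {group rT}) : Prop :=
  \pi(G) =i \pi(H) /\ prime_graph_edge G =2 prime_graph_edge H.

Definition PGL2 (F : finFieldType) : {group coset_of 'Z('GL_2[F])} :=
  ('GL_2[F] / 'Z('GL_2[F]))%G.

(* Main.v *)
Require Import Defs.
From mathcomp Require Import all_boot all_algebra all_fingroup all_solvable.
From mathcomp Require Import all_field ring.

(** The prime graph of PGL(2,49) is the path 3 - 2 - 5 together with the
isolated vertex 7.  Indeed a 2x2 matrix over a field of q elements and
characteristic p either is diagonalisable, or is a scalar plus a nilpotent, or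
generates a quadratic field extension; accordingly its power of exponent q - 1,
p or q + 1 is scalar [projective_order], so that every element order in
PGL(2,49) divides 48, 7 or 50.  Orders 14, 15, 21 and 35 are thus excluded.
Conversely, if y has odd prime order r <> p in PGL(2,q), then 2 y - tr y is
traceless, hence an involution of PGL(2,q), and it commutes with y, which gives
an element of order 2 r [PGL2_double_order].

The same graph is realised by the Frobenius groups V^n : H, where V = F^2 and
H = 2.A5 is the binary icosahedral group, seen inside SL(2,49).  An element of
SL(2,49) fixing a nonzero vector is unipotent, hence has order 1 or 7
[SL2_fixed]; as 7 does not divide the order of H, the action of H on V^n is
free, and V^n : H is a Frobenius group [affine_Frobenius].  Each of its elements
lies in V^n or in a conjugate of H, so it has no element of order 7 r for r
another prime, and the edges between 2, 3 and 5 are those of H: the central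
involution -1 yields the orders 6 and 10, while the order 15 is excluded since
an element of SL(2,49) has order dividing 2 * 48, 2 * 50 or 2 * 7 [SL2_order].
Letting n vary gives groups of pairwise distinct orders.

The subgroup H exists since F contains a square root i of -1: the rings
Z[i] / 7 and F are isomorphic, and the 120 unit icosians can be listed as
matrices over Z[i] / 7.  What is needed of them is a finite computation: they
are closed under multiplication by generators, have determinant 1, and satisfy
x^60 = 1. *)

Set Implicit Arguments.
Unset Strict Implicit.
Unset Printing Implicit Defensive.

Import GRing.Theory.
Local Open Scope ring_scope.

(** * Matrices of size two *)

Lemma ord2P (P : 'I_2 -> Prop) : P 0 -> P 1 -> forall i, P i.
Proof.
move=> P0 P1 i; have [-> // | i_n0] := eqVneq i 0.
by rewrite (_ : i = 1) //; apply: val_inj; case: i i_n0 => [[|[|]]].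
Qed.

Lemma mxtrace22 (R : comNzRingType) (A : 'M[R]_2) : \tr A = A 0 0 + A 1 1.
Proof.
rewrite /mxtrace !big_ord_recl big_ord0 addr0.
by congr (_ + A _ _); apply: val_inj.
Qed.

Lemma det22 (R : comNzRingType) (A : 'M[R]_2) :
  \det A = A 0 0 * A 1 1 - A 0 1 * A 1 0.
Proof.
rewrite (expand_det_row _ 0) !big_ord_recl big_ord0 /cofactor !det_mx11 !mxE.
rewrite /= !addn0 expr0 expr1 !mul1r mulN1r mulrN addr0.
by congr (_ * A _ _ - A _ _ * A _ _); apply: val_inj.
Qed.

Lemma mulmx22 (R : comNzRingType) (A B : 'M[R]_2) i j :
  (A *m B) i j = A i 0 * B 0 j + A i 1 * B 1 j.
Proof.
rewrite mxE !big_ord_recl big_ord0 addr0.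
by congr (_ + A _ _ * B _ _); apply: val_inj.
Qed.

(** The Cayley-Hamilton theorem in size two. *)
Lemma sqr_mx22 (R : comNzRingType) (A : 'M[R]_2) :
  A ^+ 2 = \tr A *: A - (\det A)%:M.
Proof.
apply/matrixP=> i j; rewrite expr2 mulmx22 mxtrace22 det22 !mxE.
by move: i j; apply: ord2P; apply: ord2P; rewrite /= ?mulr0n ?mulr1n; ring.
Qed.

Lemma exprD_comm_pchar (R : nzRingType) (p k : nat) (x y : R) :
  p \in [pchar R] -> GRing.comm x y ->
  (x + y) ^+ (p ^ k) = x ^+ (p ^ k) + y ^+ (p ^ k).
Proof.
move=> pcharR cxy; elim: k => [|k IHk]; first by rewrite !expn0 !expr1.
rewrite expnSr !exprM IHk -!(pFrobenius_autE pcharR).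
by rewrite pFrobenius_autD_comm //; apply/commrX/commr_sym/commrX/commr_sym.
Qed.

(** Cayley-Hamilton for a singular matrix reads N^2 = (tr N) N. *)
Lemma singular_expS (R : comNzRingType) (N : 'M[R]_2) (k : nat) :
  \det N = 0 -> N ^+ k.+1 = (\tr N) ^+ k *: N.
Proof.
move=> dN0; elim: k => [|k IHk]; first by rewrite expr1 expr0 scale1r.
rewrite exprS IHk -scalerAr -expr2 sqr_mx22 dN0 raddf0 subr0 scalerA.
by rewrite -exprSr.
Qed.

(** * Orders of matrices modulo scalars *)

Section ProjectiveOrder.

Variables (F : finFieldType) (p k : nat).
Hypotheses (pr_p : prime p) (cardF : #|F| = (p ^ k)%N).
Implicit Types (A N : 'M[F]_2).

Let pcharF : p \in [pchar F]. Proof. exact: card_finPcharP cardF pr_p. Qed.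

Let pcharM : p \in [pchar 'M[F]_2].
Proof.
rewrite inE pr_p /= -(rmorph_nat (@scalar_mx F 2)) (pcharf0 pcharF).
by rewrite raddf0.
Qed.

Let cardF_pred : #|F|.-1.+1 = #|F|.
Proof. exact: prednK (ltnW (finNzRing_gt1 F)). Qed.

Lemma unit_expr_card A : A \in unitmx -> A ^+ #|F| = A -> A ^+ #|F|.-1 = 1.
Proof.
move=> uA defA; apply: (mulrI (uA : A \is a GRing.unit)).
by rewrite -exprS cardF_pred mulr1.
Qed.

(** The vanishing of trace and determinant makes N^2 = 0, and the Frobenius map
is additive on the commuting matrices a and N. *)
Lemma exp_scalarD_nilp (a : F) N :
  \tr N = 0 -> \det N = 0 -> (a%:M + N) ^+ p = (a ^+ p)%:M.
Proof.
move=> trN dN; rewrite -[p]expn1 (exprD_comm_pchar _ pcharM) ?expn1; last first.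
  exact/esym/scalar_mxC.
case: p pr_p => [|[|m]] // _; rewrite (singular_expS m.+1 dN) trN expr0n.
by rewrite scale0r addr0 -rmorphXn.
Qed.

(** With N = A - a singular, N^2 = (tr N) N.  If tr N = 0 then A is a scalar
plus a nilpotent; otherwise N^q = (tr N)^(q-1) N = N, so that
A^q = a^q + N^q = A. *)
Lemma eigen_projective_order A (a : F) :
    A \in unitmx -> \det (A - a%:M) = 0 ->
  A ^+ #|F|.-1 = 1 \/ is_scalar_mx (A ^+ p).
Proof.
set N := A - a%:M => uA dN; have defA : A = a%:M + N by rewrite addrC subrK.
have caN : GRing.comm a%:M N by apply/esym/scalar_mxC.
have [trN | trN] := eqVneq (\tr N) 0; [right | left].
  by rewrite defA exp_scalarD_nilp // scalar_mx_is_scalar.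
have trNq : (\tr N) ^+ #|F|.-1 = 1.
  by apply: (mulfI trN); rewrite -exprS cardF_pred expf_card mulr1.
apply: unit_expr_card => //.
rewrite {1}defA cardF (exprD_comm_pchar _ pcharM caN) -cardF.
rewrite -rmorphXn /= expf_card -{1}cardF_pred (singular_expS _ dN) trNq.
by rewrite scale1r -defA.
Qed.

(** If A has no eigenvalue, then B = A^q is another root of the characteristic
polynomial of A, which has coefficients in F.  Since A generates a field, either
B = A or B is the conjugate tr A - A; in the latter case A^(q+1) = det A. *)
Lemma projective_order A : A \in unitmx ->
  [\/ is_scalar_mx (A ^+ #|F|.-1), is_scalar_mx (A ^+ #|F|.+1)
    | is_scalar_mx (A ^+ p)].
Proof.
move=> uA; have [/existsP[a /eqP dAa] | noeig] :=
  boolP [exists a, \det (A - a%:M) == 0].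
  have [-> | sAp] := eigen_projective_order uA dAa; last by constructor 3.
  by constructor 1; rewrite scalar_mx_is_scalar.
have [r [s defB]] : exists r s, A ^+ #|F| = r *: A + s%:M.
  elim: #|F| => [|n [r [s IHn]]].
    by exists 0, 1; rewrite scale0r add0r expr0.
  exists (r * \tr A + s), (- (r * \det A)).
  rewrite exprS IHn mulrDr -scalerAr -expr2 sqr_mx22 scalerBr scalerA.
  rewrite scale_scalar_mx [A * _]mul_mx_scalar scalerDl raddfN /=.
  by rewrite addrAC.
set B := A ^+ #|F| in defB *.
have sqrB : B ^+ 2 = \tr A *: B - (\det A)%:M.
  rewrite -exprM mulnC exprM sqr_mx22 -raddfN {1}cardF.
  rewrite (exprD_comm_pchar _ pcharM); last exact/scalar_mxC.
  by rewrite -cardF exprZn -/B -rmorphXn /= !expf_card.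
have cAB : GRing.comm A B by apply/commrX.
have prodB : (B - A) * (B + A) = (B - A) * (\tr A)%:M.
  rewrite mulrDr !mulrBl cAB addrA subrK -!expr2 sqrB (sqr_mx22 A).
  by rewrite opprB addrA subrK ![_ * _%:M]mul_mx_scalar.
have [BA0 | BA_n0] := eqVneq (B - A) 0.
  constructor 1; rewrite unit_expr_card ?scalar_mx_is_scalar //.
  by apply/eqP; rewrite -subr_eq0 -/B BA0.
(* B - A is in the field F[A], so it is invertible as soon as it is nonzero. *)
suff uBA : B - A \is a GRing.unit.
  constructor 2; rewrite exprS -/B.
  have -> : B = (\tr A)%:M - A by rewrite -(mulrI uBA prodB) addrK.
  rewrite mulrBr [A * _%:M]mul_mx_scalar -expr2 sqr_mx22 opprB addrC subrK.
  exact: scalar_mx_is_scalar.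
have {defB} defBA : B - A = (r - 1) *: A + s%:M.
  by rewrite defB scalerBl scale1r addrAC.
rewrite {}defBA in BA_n0 *; have [r1 | r1] := eqVneq (r - 1) 0.
  rewrite r1 scale0r add0r in BA_n0 *.
  rewrite rmorph_unit // unitfE; apply: contraNneq BA_n0 => ->.
  by rewrite raddf0.
have -> : (r - 1) *: A + s%:M = (r - 1) *: (A - (- (s / (r - 1)))%:M).
  rewrite scalerBr [(- _)%:M]raddfN scalerN opprK scale_scalar_mx.
  by rewrite mulrC divfK.
rewrite -[_ \is a GRing.unit]/(_ \in unitmx) unitmxZ ?unitfE //.
by rewrite unitmxE unitfE; have/existsPn/(_ (- (s / (r - 1)))) := noeig.
Qed.

End ProjectiveOrder.

(** * Element orders in PGL(2,q) *)

Definition mx2 (R : comNzRingType) (a b c d : R) : 'M[R]_2 :=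
  \matrix_(i, j) if i == 0 then if j == 0 then a else b
                 else if j == 0 then c else d.

Lemma mx2M (R : comNzRingType) (a b c d a' b' c' d' : R) :
  mx2 a b c d * mx2 a' b' c' d' =
  mx2 (a * a' + b * c') (a * b' + b * d') (c * a' + d * c') (c * b' + d * d').
Proof.
apply/matrixP=> i j; rewrite mulmx22 !mxE.
by move: i j; apply: ord2P; apply: ord2P.
Qed.

Lemma det_mx2 (R : comNzRingType) (a b c d : R) :
  \det (mx2 a b c d) = a * d - b * c.
Proof. by rewrite det22 !mxE. Qed.

Lemma mx2_scalar (R : comNzRingType) (a : R) : a%:M = mx2 a 0 0 a.
Proof.
apply/matrixP=> i j; rewrite !mxE.
by move: i j; apply: ord2P; apply: ord2P.
Qed.

Section GL2.

Variable F : finFieldType.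
Implicit Types (g h : {'GL_2[F]}).

Definition GL_of (A : 'M[F]_2) (uA : A \in unitmx) : {'GL_2[F]} :=
  FinRing.Unit uA.

(** A matrix commuting with both elementary transvections is scalar. *)
Lemma center_GL2 g : (g \in 'Z('GL_2[F]))%g = is_scalar_mx (val g).
Proof.
apply/idP/is_scalar_mxP => [/centerP[_ cg] | [a def_g]]; last first.
  apply/centerP; split=> [|h _]; first by rewrite inE.
  by apply: val_inj; rewrite /= def_g [LHS]mul_scalar_mx [RHS]mul_mx_scalar.
have c_g A (uA : A \in unitmx) i j : (val g *m A) i j = (A *m val g) i j.
  by have /(congr1 val)/matrixP/(_ i j) := cg (GL_of uA) (in_setT _).
have uU : mx2 1 1 0 1 \in @unitmx F 2.
  by rewrite unitmxE det_mx2 mulr1 mulr0 subr0 unitr1.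
have uL : mx2 1 0 1 1 \in @unitmx F 2.
  by rewrite unitmxE det_mx2 mulr1 mul0r subr0 unitr1.
have := c_g _ uU 0 0; have := c_g _ uU 0 1; have := c_g _ uL 0 0.
rewrite !mulmx22 !mxE /= !(mulr1, mulr0, mul1r, mul0r, addr0).
set a := val g 0 0; set b := val g 0 1; set d := val g 1 1.
move=> /(canRL (addKr _)); rewrite addNr => b0.
rewrite b0 addr0 add0r => a_d /esym/(canRL (addKr _)); rewrite addNr => c0.
exists a; apply/matrixP=> i j; rewrite mx2_scalar mxE.
by move: i j; apply: ord2P; apply: ord2P.
Qed.

Lemma val_GLX g n : val (g ^+ n)%g = val g ^+ n.
Proof. exact: FinRing.val_unitX. Qed.

Lemma GL2_normZ g : g \in 'N('Z('GL_2[F]))%g.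
Proof. by apply: (subsetP (gFnorm _ _)); rewrite inE. Qed.

Lemma coset_GL2X_eq1 g n :
  ((coset 'Z('GL_2[F]) g ^+ n)%g == 1%g) = is_scalar_mx (val g ^+ n).
Proof.
rewrite -morphX ?GL2_normZ //= -val_GLX -center_GL2.
apply/eqP/idP.
  exact: (@coset_idr _ 'Z('GL_2[F])%G (g ^+ n)%g (GL2_normZ _)).
exact: (@coset_id _ 'Z('GL_2[F])%G (g ^+ n)%g).
Qed.

Lemma PGL2P x : reflect (exists g, x = coset 'Z('GL_2[F]) g) (x \in PGL2 F).
Proof.
apply: (iffP idP) => [/morphimP[g _ _ ->] | [g ->]]; first by exists g.
by rewrite mem_quotient ?inE.
Qed.

Variables (p k : nat).
Hypotheses (pr_p : prime p) (cardF : #|F| = (p ^ k)%N).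

Lemma PGL2_order x : x \in PGL2 F ->
  [\/ #[x]%g %| #|F|.-1, #[x]%g %| #|F|.+1 | #[x]%g %| p]%N.
Proof.
case/PGL2P=> g ->; rewrite !order_dvdn !coset_GL2X_eq1.
exact: projective_order pr_p cardF _ (GL_unitmx g).
Qed.

(** Writing t = tr g, the matrix w = 2 g - t is traceless, so w^2 = - det w is
scalar.  It is invertible, for otherwise w^2 = 0 and 2 g = t + w would have a
scalar power of exponent p.  Hence w maps to an involution commuting with x. *)
Lemma PGL2_double_order x :
    x \in PGL2 F -> prime #[x]%g -> #[x]%g != 2 -> #[x]%g != p -> p != 2 ->
  exists2 z, z \in PGL2 F & #[z]%g = (2 * #[x]%g)%N.
Proof.
move=> /PGL2P[g def_x] pr_x x_n2 x_np p_n2.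
have n2 : 2%:R != 0 :> F.
  have pcharF := card_finPcharP cardF pr_p.
  by rewrite -(dvdn_pcharf pcharF) dvdn_prime2.
pose t : F := \tr (val g); pose w := 2%:R *: val g - t%:M.
have trw : \tr w = 0.
  by rewrite mxtrace22 !mxE /t mxtrace22 /= !mulr1n; ring.
have sqrw : w ^+ 2 = (- \det w)%:M by rewrite sqr_mx22 trw scale0r sub0r raddfN.
have defg : val g = 2%:R^-1 *: (t%:M + w) by rewrite addrC subrK scalerK.
have Nscal_g n : coprime n #[x]%g -> ~~ is_scalar_mx (val g ^+ n).
  rewrite -coset_GL2X_eq1 -def_x -order_dvdn => co_nx.
  apply: contraL pr_x => x_n.
  by move: co_nx; rewrite /coprime (gcdn_idPr x_n) => /eqP->.
have uw : w \in unitmx.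
  rewrite unitmxE unitfE; apply/eqP=> dw.
  have co_px : coprime p #[x]%g.
    by rewrite prime_coprime // dvdn_prime2 // eq_sym.
  apply: (negP (Nscal_g p co_px)).
  rewrite defg exprZn (exp_scalarD_nilp pr_p cardF) // scale_scalar_mx.
  exact: scalar_mx_is_scalar.
have cgw : commute g (GL_of uw).
  apply: val_inj; rewrite /= [LHS]mulrBr [RHS]mulrBl.
  rewrite [val g * _%:M]mul_mx_scalar [_%:M * val g]mul_scalar_mx.
  by rewrite -scalerAl -scalerAr.
pose y := coset 'Z('GL_2[F]) (GL_of uw).
have oy : #[y]%g = 2.
  apply: nt_prime_order => //.
    by apply/eqP; rewrite coset_GL2X_eq1 /= sqrw scalar_mx_is_scalar.
  rewrite -(expg1 y) coset_GL2X_eq1 expr1 /=.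
  apply: contra (Nscal_g 1 (coprime1n _)).
  case/is_scalar_mxP=> a def_w.
  by rewrite expr1 defg def_w -raddfD scale_scalar_mx scalar_mx_is_scalar.
exists (y * x)%g.
  by rewrite def_x groupM //; apply/PGL2P; [exists (GL_of uw) | exists g].
rewrite orderM ?oy //; last by rewrite prime_coprime // dvdn_prime2 // eq_sym.
by rewrite /commute def_x -!morphM ?GL2_normZ //= cgw.
Qed.

(** The transvection [1 1; 0 1] does not become trivial modulo scalars. *)
Lemma PGL2_unipotent : exists2 x, x \in PGL2 F & #[x]%g = p.
Proof.
have uU : mx2 1 1 0 1 \in @unitmx F 2.
  by rewrite unitmxE det_mx2 mulr1 mulr0 subr0 unitr1.
pose x := coset 'Z('GL_2[F]) (GL_of uU).
exists x; first by apply/PGL2P; exists (GL_of uU).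
apply: nt_prime_order => //; apply/eqP.
  rewrite coset_GL2X_eq1 /=.
  have -> : mx2 1 1 0 1 = 1%:M + mx2 0 1 0 0 :> 'M[F]_2.
    apply/matrixP=> i j; rewrite mx2_scalar !mxE.
    by move: i j; apply: ord2P; apply: ord2P; rewrite /= ?addr0 ?add0r.
  rewrite (exp_scalarD_nilp pr_p cardF) ?scalar_mx_is_scalar //.
    by rewrite mxtrace22 !mxE addr0.
  by rewrite det_mx2 !mulr0 subr0.
rewrite -[x]expg1; apply/eqP; rewrite coset_GL2X_eq1 expr1 /=.
apply/is_scalar_mxP=> [[a /matrixP/(_ 0 1)]].
by rewrite !mxE => /eqP; rewrite oner_eq0.
Qed.
End GL2.

(** * The binary icosahedral group *)

(** The pair (a, b) of residues modulo 7 stands for a + b i, where i^2 = -1. *)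
Definition gauss := (nat * nat)%type.
Definition gaddm (x y : gauss) : gauss :=
  ((x.1 + y.1) %% 7, (x.2 + y.2) %% 7)%N.
Definition gmulm (x y : gauss) : gauss :=
  ((x.1 * y.1 + 6 * (x.2 * y.2)) %% 7, (x.1 * y.2 + x.2 * y.1) %% 7)%N.

Definition gmat := (gauss * gauss * gauss * gauss)%type.
Definition gmat1 : gmat := ((1, 0), (0, 0), (0, 0), (1, 0))%N.
Definition gmatM (m n : gmat) : gmat :=
  let: (a, b, c, d) := m in let: (a', b', c', d') := n in
  (gaddm (gmulm a a') (gmulm b c'), gaddm (gmulm a b') (gmulm b d'),
   gaddm (gmulm c a') (gmulm d c'), gaddm (gmulm c b') (gmulm d d')).
Definition gmatX (m : gmat) (n : nat) : gmat := iter n (gmatM m) gmat1.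
Definition gdet (m : gmat) : gauss :=
  let: (a, b, c, d) := m in
  gaddm (gmulm a d) (gmulm (6, 0)%N (gmulm b c)).

(** The quaternion units I and J, generating with
K = I J the quaternion group Q8. *)
Definition quatI : gmat := ((0, 1), (0, 0), (0, 0), (0, 6))%N.
Definition quatJ : gmat := ((0, 0), (1, 0), (6, 0), (0, 0))%N.
(** The Hurwitz unit (-1 + I + J + K) / 2, of order 3. *)
Definition quatW : gmat := ((3, 4), (4, 4), (3, 4), (3, 3))%N.
(** The icosian (- phi + (1 - phi) I + J) / 2 of order 5, where
phi = (1 + r) / 2 = 4 + 5 i is the golden ratio for the square root r = 3 i
of 5. *)
Definition icosC : gmat := ((4, 3), (4, 0), (3, 0), (6, 6))%N.

Definition gpowers (m : gmat) (n : nat) : seq gmat := map (gmatX m) (iota 0 n).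
Definition gprods (s t : seq gmat) : seq gmat :=
  [seq gmatM x y | x <- s, y <- t].

(** The binary icosahedral group has the exact factorisation C5 * 2T, where the
binary tetrahedral group 2T is itself C3 * Q8; this lists its 120 elements. *)
Definition icosians : seq gmat :=
  gprods (gpowers icosC 5)
    (gprods (gpowers quatW 3) (gprods (gpowers quatJ 2) (gpowers quatI 4))).

Definition icosian_gens : seq gmat := [:: quatI; quatW; icosC].

Lemma icosians_closed :
  all (fun x => all (fun g => gmatM x g \in icosians) icosian_gens) icosians.
Proof. by vm_compute. Qed.

(** The exponent 60 = 4 * 3 * 5 is split to shorten the computation. *)
Lemma icosians_exponent :
  all (fun x => gmatX (gmatX (gmatX x 4) 3) 5 == gmat1) icosians.
Proof. by vm_compute. Qed.

Lemma icosians1 : gmat1 \in icosians. Proof. by vm_compute. Qed.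

Lemma icosian_gens_sub : all [in icosians] icosian_gens.
Proof. by vm_compute. Qed.

Lemma icosians_det : all (fun x => gdet x == (1, 0)%N) icosians.
Proof. by vm_compute. Qed.

(* This keeps unification from enumerating the list. *)
#[local] Opaque icosians.

(** In a finite group inverses are products, so a subgroup is generated by
products alone. *)
Lemma gen_ind (gT : finGroupType) (A : {set gT}) (P : gT -> Prop) :
    P 1%g -> (forall x g, P x -> g \in A -> P (x * g)%g) ->
  forall x, x \in <<A>>%g -> P x.
Proof.
move=> P1 PM _ /gen_prodgP[n [c cA ->]].
elim: n c cA => [|n IHn] c cA; first by rewrite big_ord0.
by rewrite big_ord_recr; apply: PM => //; apply: IHn.
Qed.

Section Icosahedral.

Variable F : finFieldType.
Hypothesis cardF : #|F| = 49%N.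

Let pcharF : 7%N \in [pchar F].
Proof. exact: (@card_finPcharP F 7 2 cardF isT). Qed.

(** Some nonzero a has a^24 <> 1, as 'X^24 - 1 has at most 24 < 48 roots; then
a^24 = -1 because a^48 = 1. *)
Lemma exists_sqrtN1 : exists i : F, i ^+ 2 = -1.
Proof.
have [a a_n0 a24] : exists2 a : F, a != 0 & a ^+ 24 != 1.
  have [/existsP[a /andP[]] | all24] :=
    boolP [exists a : F, (a != 0) && (a ^+ 24 != 1)]; first by exists a.
  have unity24 : all 24.-unity_root (enum [set~ 0 : F]).
    apply/allP=> a; rewrite mem_enum !inE unity_rootE => a_n0.
    by have/existsPn/(_ a) := all24; rewrite a_n0 negbK.
  have := @max_unity_roots F 24 _ isT unity24 (enum_uniq _).
  by rewrite -cardE cardsC1 cardF.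
exists (a ^+ 12); rewrite -exprM; apply/eqP.
have : (a ^+ 24) ^+ 2 == 1.
  rewrite -exprM; apply/eqP/(mulfI a_n0).
  by rewrite -exprS mulr1 -[RHS]expf_card cardF.
by rewrite sqrf_eq1 (negPf a24).
Qed.

Variable i : F.
Hypothesis sqr_i : i ^+ 2 = -1.

Definition gev (x : gauss) : F := x.1%:R + x.2%:R * i.
Definition gmx (m : gmat) : 'M[F]_2 :=
  let: (a, b, c, d) := m in mx2 (gev a) (gev b) (gev c) (gev d).

Let natm n : (n %% 7)%:R = n%:R :> F.
Proof. exact: (GRing.natr_mod_pchar pcharF). Qed.

Let nat6 : 6%:R = -1 :> F.
Proof. by apply/eqP; rewrite -subr_eq0 opprK natr1 (pcharf0 pcharF). Qed.

Lemma gevD x y : gev (gaddm x y) = gev x + gev y.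
Proof. by rewrite /gev /= !natm !natrD; ring. Qed.

Lemma gevM x y : gev (gmulm x y) = gev x * gev y.
Proof.
rewrite /gev /= !natm (natrD _ (x.1 * y.1)) (natrD _ (x.1 * y.2)) !natrM nat6.
ring: sqr_i.
Qed.

Lemma gmxM m n : gmx (gmatM m n) = gmx m * gmx n.
Proof.
by case: m n => [[[a b] c] d] [[[a' b'] c'] d']; rewrite /= mx2M !gevD !gevM.
Qed.

Lemma gmx1 : gmx gmat1 = 1.
Proof. by rewrite /gmx /gev /= mul0r !addr0 -mx2_scalar. Qed.

Lemma gmxX m n : gmx (gmatX m n) = gmx m ^+ n.
Proof. by elim: n => [|n IHn]; rewrite ?gmx1 //= gmxM IHn exprS. Qed.

Lemma gevN1 : gev (6, 0)%N = -1.
Proof. by rewrite /gev /= nat6 mul0r addr0. Qed.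

Lemma det_gmx m : \det (gmx m) = gev (gdet m).
Proof.
case: m => [[[a b] c] d]; rewrite /= det_mx2 gevD !gevM.
by rewrite gevN1 mulN1r.
Qed.

Definition gGL (m : gmat) : {'GL_2[F]} := insubd (1%g : {'GL_2[F]}) (gmx m).

Lemma val_gGL m : m \in icosians -> val (gGL m) = gmx m.
Proof.
move=> /(allP icosians_det)/eqP det_m; apply: insubdK.
rewrite -[_ \in _]/(gmx m \in unitmx) unitmxE det_gmx det_m.
by rewrite /gev /= mul0r addr0 unitr1.
Qed.

Lemma gGLM m n : m \in icosians -> n \in icosians -> gmatM m n \in icosians ->
  gGL (gmatM m n) = (gGL m * gGL n)%g.
Proof.
by move=> Sm Sn Smn; apply: val_inj; rewrite /= !val_gGL // gmxM.
Qed.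

Definition binary_icosahedral : {group {'GL_2[F]}} :=
  <<[set gGL quatI; gGL quatW; gGL icosC]>>%G.

Lemma binary_icosahedralP h :
  h \in binary_icosahedral -> exists2 m, m \in icosians & h = gGL m.
Proof.
move: h; apply: gen_ind => [|_ x [m Sm ->] gens_x].
  exists gmat1; first exact: icosians1.
  by apply: val_inj; rewrite val_gGL ?gmx1 ?icosians1.
have [g Ag ->] : exists2 g, g \in icosian_gens & x = gGL g.
  by case/setUP: gens_x => [/set2P[]|/set1P] ->;
     [exists quatI | exists quatW | exists icosC].
have Smg : gmatM m g \in icosians by apply: (allP (allP icosians_closed m Sm)).
have Sg : g \in icosians by apply: (allP icosian_gens_sub).
by exists (gmatM m g); rewrite // gGLM.
Qed.

Lemma binary_icosahedral_det h : h \in binary_icosahedral -> \det (val h) = 1.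
Proof.
case/binary_icosahedralP=> m Sm ->.
by rewrite val_gGL // det_gmx (eqP (allP icosians_det m Sm)) /gev mul0r addr0.
Qed.

Lemma binary_icosahedral_exponent h :
  h \in binary_icosahedral -> (h ^+ 60 = 1)%g.
Proof.
case/binary_icosahedralP=> m Sm ->; apply: val_inj.
rewrite val_GLX val_gGL // (exprM _ 12 5) (exprM _ 4 3) -!gmxX.
by rewrite (eqP (allP icosians_exponent m Sm)) gmx1.
Qed.

Lemma gev_neq0 x y : gmulm x y = (1, 0)%N -> gev x != 0.
Proof.
move=> xy1; apply/eqP=> x0; have := gevM x y.
by rewrite xy1 x0 mul0r /gev mul0r addr0 => /eqP; rewrite oner_eq0.
Qed.

(** An invertible upper right entry of the matrix witnesses that it differs from
1 over F as well. *)
Lemma order_gGL m r y :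
    m \in icosians -> prime r -> gmatX m r = gmat1 ->
    gmulm m.1.1.2 y = (1, 0)%N ->
  #[gGL m]%g = r.
Proof.
move=> Sm pr_r mr my; apply: nt_prime_order => //.
  by apply: val_inj; rewrite val_GLX val_gGL // -gmxX mr gmx1.
apply/eqP=> /(congr1 val)/matrixP/(_ 0 1); rewrite val_gGL // !mxE.
have := gev_neq0 my; case: m {Sm mr my} => [[[a b] c] d] /=.
by rewrite !mxE => /eqP.
Qed.
End Icosahedral.

(** These are the only properties of the binary icosahedral group used below;
they say that it lies in SL(2,49), has order prime to 7, and that its prime
graph has the edges 2 - 3 and 2 - 5. *)
Lemma exists_binary_icosahedral (F : finFieldType) :
    #|F| = 49%N ->
  exists H : {group {'GL_2[F]}},
    [/\ forall h, h \in H -> \det (val h) = 1,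
        forall h, h \in H -> (h ^+ 60 = 1)%g,
        exists2 z, z \in H & val z = (-1)%:M,
        exists2 x, x \in H & #[x]%g = 3%N
      & exists2 x, x \in H & #[x]%g = 5%N].
Proof.
move=> cardF; have [i sqr_i] := exists_sqrtN1 cardF.
have genH m : m \in icosian_gens -> gGL i m \in binary_icosahedral i.
  rewrite !inE => gens_m; apply: mem_gen; rewrite !inE.
  by case/or3P: gens_m => /eqP->; rewrite eqxx ?orbT.
have gens_sub m : m \in icosian_gens -> m \in icosians.
  exact: (allP icosian_gens_sub).
exists (binary_icosahedral i); split.
- exact: binary_icosahedral_det.
- exact: binary_icosahedral_exponent.
- have HI : gGL i quatI \in binary_icosahedral i by apply: genH.
  exists (gGL i quatI * gGL i quatI)%g; first by rewrite groupM.
  rewrite /= (val_gGL cardF sqr_i) ?gens_sub // -(gmxM cardF sqr_i).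
  have -> : gmatM quatI quatI = ((6, 0), (0, 0), (0, 0), (6, 0))%N by [].
  by rewrite mx2_scalar -(gevN1 cardF i) /gmx /gev /= !mul0r !addr0.
- exists (gGL i quatW); first by rewrite genH.
  exact: (@order_gGL _ cardF _ sqr_i _ 3 (1, 6)%N); rewrite ?gens_sub //.
exists (gGL i icosC); first by rewrite genH.
exact: (@order_gGL _ cardF _ sqr_i _ 5 (2, 0)%N); rewrite ?gens_sub //.
Qed.

(** * The special linear group and affine Frobenius groups *)

Section SL2.

Variables (F : finFieldType) (p k : nat).
Hypotheses (pr_p : prime p) (cardF : #|F| = (p ^ k)%N).
Implicit Type g : {'GL_2[F]}.

(** A scalar of determinant 1 has square 1. *)
Lemma SL2_order g : \det (val g) = 1 ->
  [\/ #[g]%g %| 2 * #|F|.-1, #[g]%g %| 2 * #|F|.+1 | #[g]%g %| 2 * p]%N.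
Proof.
move=> det_g.
have scalar_order n : is_scalar_mx (val g ^+ n) -> (#[g]%g %| 2 * n)%N.
  case/is_scalar_mxP=> a gn; rewrite order_dvdn; apply/eqP/val_inj.
  rewrite val_GLX mulnC exprM gn -rmorphXn /= -(det_scalar 2 a) -gn.
  by elim: n {gn} => [|n IHn]; rewrite ?expr0 ?det1 // exprS detM det_g mul1r.
by case: (projective_order pr_p cardF (GL_unitmx g)) => /scalar_order;
  [constructor 1 | constructor 2 | constructor 3].
Qed.

(** If g fixes a nonzero row vector, then N = g - 1 is singular, and
det g = 1 + tr N + det N forces tr N = 0; thus g = 1 + N is unipotent. *)
Lemma SL2_fixed n (X : 'M[F]_(n, 2)) g :
  \det (val g) = 1 -> X *m val g = X -> X != 0 -> (g ^+ p)%g = 1%g.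
Proof.
move=> det_g fixX X_n0; set N := val g - 1.
have dN : \det N = 0.
  apply/eqP; apply: contraNT X_n0 => dN_n0.
  have uN : N \in unitmx by rewrite unitmxE unitfE.
  by rewrite -(mulmxK uN X) mulmxBr fixX mulmx1 subrr mul0mx.
have trN : \tr N = 0.
  have -> : \tr N = \det (val g) - 1 - \det N.
    by rewrite mxtrace22 !det22 !mxE /= mulr1n mulr0n; ring.
  by rewrite det_g dN subrr subr0.
apply: val_inj; rewrite val_GLX -[val g](subrK 1) addrC.
by rewrite (exp_scalarD_nilp pr_p cardF) // expr1n.
Qed.

End SL2.

Section AffineGroup.

Variables (F : finFieldType) (n : nat) (H : {group {'GL_2[F]}}).

(** The rows of X are n vectors of F^2 on which g acts simultaneously. *)
Definition mulGL (X : 'M[F]_(n, 2)) (g : {'GL_2[F]}) := X *m val g.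

Lemma mulGL_is_action : is_action H mulGL.
Proof.
split=> [g X Y eqXY | X g h _ _]; last by rewrite /mulGL mulmxA.
by rewrite -(mulmxK (GL_unitmx g) X) -(mulmxK (GL_unitmx g) Y) [X *m _]eqXY.
Qed.

Definition mulGL_action := Action mulGL_is_action.

Lemma mulGL_is_groupAction : is_groupAction [set: 'M[F]_(n, 2)] mulGL_action.
Proof.
move=> g Hg; rewrite inE; apply/andP; split.
  by apply/subsetP=> X; rewrite inE.
by apply/morphicP=> X Y _ _; rewrite !actpermE; apply: mulmxDl.
Qed.

Definition mulGL_groupAction := GroupAction mulGL_is_groupAction.

Hypotheses (n_gt0 : (0 < n)%N) (H_n1 : H != 1%G).
Hypothesis freeH :
  forall (X : 'M[F]_(n, 2)) h, h \in H -> X *m val h = X -> X != 0 -> h = 1%g.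

Lemma affine_Frobenius :
  [Frobenius [set: sdprod_by mulGL_groupAction] =
     sdpair1 mulGL_groupAction @* [set: 'M[F]_(n, 2)]
       ><| sdpair2 mulGL_groupAction @* H]%g.
Proof.
have sd := sdprod_sdpair mulGL_groupAction.
apply/(Frobenius_semiregularP sd).
- rewrite -cardG_gt1 card_injm ?injm_sdpair1 // cardsT card_mx.
  apply: leq_trans (finNzRing_gt1 F) _.
  by rewrite -{1}(expn1 #|F|) leq_exp2l ?finNzRing_gt1 // muln_gt0 n_gt0.
- by rewrite -cardG_gt1 card_injm ?injm_sdpair2 // cardG_gt1.
move=> y /setD1P[y_n1 /morphimP[h _ Hh def_y]].
apply/trivgP/subsetP=> _ /setIP[/morphimP[X _ _ ->] /cent1P cXy].
have fixX : X *m val h = X.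
  apply: (injmP (injm_sdpair1 mulGL_groupAction)); rewrite ?inE //.
  have /= -> := sdpair_act mulGL_groupAction (in_setT X) Hh.
  by rewrite -def_y /conjg cXy mulKg.
rewrite inE; have [-> | X_n0] := eqVneq X 0.
  by rewrite -(morph1 (sdpair1_morphism mulGL_groupAction)).
by case/eqP: y_n1; rewrite def_y (freeH Hh fixX X_n0) morph1.
Qed.
End AffineGroup.

(** * The prime graph 3 - 2 - 5, 7 *)

Local Close Scope ring_scope.
Local Open Scope group_scope.

Section PrimeGraph.

Variables (gT : finGroupType) (X : {group gT}).

(** Conditions on element orders that determine the prime graph to be the path
3 - 2 - 5 with 7 isolated: 48 and 100 are multiples of 6 and 10, but none of the
three bounds is a multiple of 14, 15, 21 or 35. *)
Definition path325_iso7 : Prop :=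
  [/\ exists2 x, x \in X & #[x] = 6, exists2 x, x \in X & #[x] = 10,
      exists2 x, x \in X & #[x] = 7
    & forall x, x \in X -> [|| #[x] %| 48, #[x] %| 100 | #[x] %| 7]].

Hypothesis specX : path325_iso7.

Lemma path325_iso7_vertices : \pi(X) =i [:: 2; 3; 5; 7].
Proof.
case: specX => [[x6 X6 o6] [x10 X10 o10] [x7 X7 o7] ordX] r.
apply/idP/idP=> [| r2357].
  rewrite mem_primes => /and3P[pr_r _ /(Cauchy pr_r)[x /ordX + ox]].
  have mem_r n : 0 < n -> r %| n -> r \in primes n.
    by move=> n_gt0 r_n; rewrite mem_primes pr_r n_gt0.
  rewrite ox => /or3P[/(mem_r 48 isT) | /(mem_r 100 isT) | /(mem_r 7 isT)].
  - by rewrite !inE => /orP[] /eqP->.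
  - by rewrite !inE => /orP[] /eqP->.
  by rewrite !inE => /eqP->.
have in_pi n m : prime r -> r %| m -> n = m -> n %| #|X| -> r \in \pi(X).
  by move=> pr_r r_m -> m_X; rewrite mem_primes pr_r cardG_gt0 (dvdn_trans r_m).
move: r2357; rewrite !inE => /or4P[] /eqP def_r; rewrite {}def_r in in_pi *.
- exact: in_pi o6 (order_dvdG X6).
- exact: in_pi o6 (order_dvdG X6).
- exact: in_pi o10 (order_dvdG X10).
exact: in_pi o7 (order_dvdG X7).
Qed.

Lemma path325_iso7_edges r s :
  prime_graph_edge X r s = ((r, s) \in [:: (2, 3); (3, 2); (2, 5); (5, 2)]).
Proof.
have [[x6 X6 o6] [x10 X10 o10] _ ordX] := specX.
rewrite /prime_graph_edge !path325_iso7_vertices.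
apply/and4P/idP=> [[r2357 s2357 + /exists_inP[x /ordX + /eqP ox]] |].
  rewrite {}ox; move: r2357 s2357; rewrite !inE.
  by case/or4P=> /eqP-> /or4P[] /eqP->.
have edge a b c x : x \in X -> #[x] = c -> c = (a * b)%N ->
  [exists x in X, #[x] == (a * b)%N].
  by move=> Xx ox def_c; apply/exists_inP; exists x; rewrite ?ox ?def_c.
rewrite !inE => /or4P[] /eqP[-> ->]; split=> //.
- exact: edge X6 o6 _.
- exact: edge X6 o6 _.
- exact: edge X10 o10 _.
exact: edge X10 o10 _.
Qed.

End PrimeGraph.

Lemma path325_iso7_eq (gT rT : finGroupType) (X : {group gT}) (Y : {group rT}) :
  path325_iso7 X -> path325_iso7 Y -> eq_prime_graph X Y.
Proof.
move=> specX specY; split=> [r | r s].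
  by rewrite (path325_iso7_vertices specX) (path325_iso7_vertices specY).
by rewrite (path325_iso7_edges specX) (path325_iso7_edges specY).
Qed.

(** A Frobenius group is partitioned by its kernel and the conjugates of the
nontrivial part of a complement. *)
Lemma Frobenius_order (gT : finGroupType) (G K H : {group gT}) x :
    [Frobenius G = K ><| H] -> x \in G ->
  x \in K \/ exists2 h, h \in H & #[x] = #[h].
Proof.
move=> frobG; rewrite -(cover_partition (Frobenius_partition frobG)).
case/bigcupP=> A /setU1P[-> Kx | /imsetP[y _ ->]]; first by left.
rewrite mem_conjg => /setD1P[_ Hxy]; right.
by exists (x ^ y^-1); rewrite ?orderJ.
Qed.

Section Final.

Variable F : finFieldType.
Hypothesis cardF : #|F| = 49.

Let cardF' : #|F| = (7 ^ 2)%N := cardF.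

(** Elements of order 3 and 5 in SL(2,49) keep their order in PGL(2,49), the
only scalars of determinant 1 being 1 and -1; the involutions commuting
with them give the orders 6 and 10. *)
Lemma PGL2_49_spectrum (H : {group {'GL_2[F]}}) :
    (forall h, h \in H -> (\det (val h) = 1)%R) ->
    (exists2 x, x \in H & #[x] = 3) -> (exists2 x, x \in H & #[x] = 5) ->
  path325_iso7 (PGL2 F).
Proof.
move=> det_H ex3 ex5.
have double r : prime r -> r != 2 -> r != 7 ->
    (exists2 x, x \in H & #[x] = r) ->
    exists2 x, x \in PGL2 F & #[x] = (2 * r)%N.
  move=> pr_r r_n2 r_n7 [x Hx ox].
  pose y := coset 'Z('GL_2[F]) x.
  have PGLy : y \in PGL2 F by apply/PGL2P; exists x.
  have oy : #[y] = r.
    apply: nt_prime_order => //.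
      by rewrite /y -morphX ?GL2_normZ //= -ox expg_order morph1.
    apply/eqP=> y1; have /eqP := y1; rewrite -[y]expg1 coset_GL2X_eq1 expr1.
    case/is_scalar_mxP=> a def_x.
    have : #[x] %| 2.
      rewrite order_dvdn; apply/eqP/val_inj; rewrite val_GLX def_x -rmorphXn /=.
      by rewrite -(det_scalar 2 a) -def_x det_H.
    by rewrite ox dvdn_prime2 // (negPf r_n2).
  by rewrite -oy; apply: (PGL2_double_order (p := 7) (k := 2)); rewrite ?oy.
split.
- exact: (double 3).
- exact: (double 5).
- exact: (@PGL2_unipotent F 7 2).
move=> x /(PGL2_order (isT : prime 7) cardF'); rewrite cardF.
case=> dvd_x; apply/or3P; [constructor 1 | constructor 2 | constructor 3] => //.
exact: dvdn_trans dvd_x _.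
Qed.

End Final.

(** * Infinitely many Frobenius groups *)

Theorem lemma3p1 (F : finFieldType) (cardF : #|F| = 49) :
  exists (gT : nat -> finGroupType) (G : forall n, {group gT n}),
    [/\ forall n, [Frobenius (G n)],
        forall n, eq_prime_graph (G n) (PGL2 F)
      & forall m n, m != n -> ~~ (G m \isog G n)].
Proof.
have cardF' : #|F| = (7 ^ 2)%N := cardF.
have [H [det_H exp_H [z Hz def_z] ex3 ex5]] := exists_binary_icosahedral cardF.
have specPGL := PGL2_49_spectrum cardF det_H ex3 ex5.
have pchar7 : 7 \in [pchar F]%R by exact: (card_finPcharP cardF').
have dvd60 h m : h \in H -> #[h] %| m -> #[h] %| gcdn 60 m.
  by move=> Hh h_m; rewrite dvdn_gcd h_m andbT order_dvdn exp_H.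
have ordH h : h \in H -> (#[h] %| 48) || (#[h] %| 100).
  move=> Hh; apply/orP.
  case: (SL2_order (isT : prime 7) cardF' (det_H h Hh)); rewrite ?cardF.
  - by move/(dvd60 h _ Hh) => h_dvd; left; apply: dvdn_trans h_dvd _.
  - by move/(dvd60 h _ Hh) => h_dvd; right; apply: dvdn_trans h_dvd _.
  by move/(dvd60 h _ Hh) => h_dvd; left; apply: dvdn_trans h_dvd _.
have freeH n (X : 'M[F]_(n, 2)) h :
    h \in H -> (X *m val h = X)%R -> (X != 0)%R -> h = 1.
  move=> Hh fixX X_n0; apply/eqP; rewrite -order_eq1 -dvdn1.
  apply: (dvd60 h 7 Hh); rewrite order_dvdn; apply/eqP.
  exact: (SL2_fixed (isT : prime 7) cardF' (det_H h Hh) fixX X_n0).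
have H_n1 : H != 1%G.
  have [x Hx ox] := ex3; apply: contra_eqN ox => /eqP H1.
  by move: Hx; rewrite H1 => /set1P->; rewrite order1.
have oz : #[z] = 2.
  apply: nt_prime_order => //.
    by apply: val_inj; rewrite val_GLX def_z -rmorphXn /= sqrrN expr1n.
  apply/eqP=> /(congr1 val)/matrixP/(_ 0 0)%R; rewrite def_z !mxE /= => /eqP.
  rewrite mulr1n -subr_eq0 -opprD oppr_eq0.
  by rewrite -[(1 + 1)%R]/(2%:R)%R -(dvdn_pcharf pchar7).
have double r : odd r -> (exists2 x, x \in H & #[x] = r) ->
    exists2 x, x \in H & #[x] = (2 * r)%N.
  move=> odd_r [x Hx ox]; exists (z * x); first exact: groupM.
  rewrite orderM ?oz ?ox ?coprime2n //; apply: val_inj.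
  by rewrite /= def_z [LHS]mul_scalar_mx [RHS]mul_mx_scalar.
pose to n := mulGL_groupAction n.+1 H.
pose gT n : finGroupType := sdprod_groupType (to n).
pose G n : {group gT n} := [set: gT n]%G.
have frobG n := affine_Frobenius (ltn0Sn n) H_n1 (@freeH n.+1).
have cardG n : #|G n| = (49 ^ (n.+1 * 2) * #|H|)%N.
  rewrite -(sdprod_card (sdprod_sdpair (to n))).
  rewrite !card_injm ?injm_sdpair1 ?injm_sdpair2 //.
  by rewrite cardsT card_mx cardF.
exists gT, G; split=> [n | n | m n m_n].
- exact: FrobeniusW (frobG n).
- apply: path325_iso7_eq specPGL.
  have ord_sd h : h \in H -> #[sdpair2 (to n) h] = #[h].
    by move=> Hh; rewrite (order_injm (injm_sdpair2 (to n))).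
  have exp7 (X : 'M[F]_(n.+1, 2)) : (sdpair1 (to n) X) ^+ 7 = 1.
    rewrite -(morphX (sdpair1_morphism (to n))) ?inE //=.
    rewrite (_ : X ^+ 7 = 1) ?morph1 //.
    by rewrite FinRing.zmodXgE -scaler_nat (pcharf0 pchar7) scale0r.
  have lift r : (exists2 h, h \in H & #[h] = r) ->
      exists2 x, x \in G n & #[x] = r.
    by case=> h Hh oh; exists (sdpair2 (to n) h); rewrite ?inE ?ord_sd.
  split.
  + exact/lift/(double 3).
  + exact/lift/(double 5).
  + pose X : 'M[F]_(n.+1, 2) := const_mx 1%R.
    exists (sdpair1 (to n) X); first by rewrite inE.
    apply: nt_prime_order => //.
    rewrite (morph_injm_eq1 (injm_sdpair1 (to n))) ?inE //.
    apply/eqP=> /matrixP/(_ 0 0)%R/eqP.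
    by rewrite !mxE oner_eq0.
  move=> x Gx; have [/morphimP[X _ _ ->] | [_ /morphimP[h _ Hh ->] ->]] :=
    Frobenius_order (frobG n) Gx.
    by apply/or3P; constructor 3; rewrite order_dvdn; apply/eqP/exp7.
  by rewrite [#[_]]ord_sd // orbA ordH.
apply: contra m_n => /card_isog; rewrite !cardG => /eqP.
by rewrite eqn_pmul2r ?cardG_gt0 // eqn_exp2l // eqn_pmul2r // eqSS.
Qed.
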